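(* Let $\Gamma$ be a non-elementary hyperbolic group and let $\psi,\psi_*$ be hyperbolic distance-like functions on $\Gamma$ such that $\mathrm{Dil}(\psi_*,\psi)<\infty$. Then there exists some $C\ge0$ such that for any $x,y\in\Gamma$ $$\psi_*(x,y)\le\mathrm{Dil}(\psi_*,\psi)\,\psi(x,y)+C.$$
   Context: $\Gamma$ is a non-elementary (i.e. not virtually cyclic) Gromov hyperbolic group with identity element $o$. A pseudo metric $d$ on $\Gamma$ is a symmetric function $d:\Gamma\times\Gamma\to[0,\infty)$ satisfying the triangle inequality and $d(x,x)=0$. For any function $\psi:\Gamma\times\Gamma\to\mathbb{R}$ the Gromov product is $(x|y)_{w,\psi}=\frac12(\psi(x,w)+\psi(w,y)-\psi(x,y))$. A pseudo metric $d$ is hyperbolic if there is $\delta\ge0$ with $(x|y)_{z,d}\ge\min\{(x|w)_{z,d},(w|y)_{z,d}\}-\delta$ for all $x,y,z,w\in\Gamma$. $\mathcal{D}_\Gamma$ is the set of all left-invariant hyperbolic pseudo metrics on $\Gamma$ that are quasi-isometric (via the identity map) to a word metric for a finite symmetric generating set. A hyperbolic distance-like function on $\Gamma$ is a function $\psi:\Gamma\times\Gamma\to\mathbb{R}$ (not necessarily symmetric) such that: (1) $\psi(x,y)\ge0$ and $\psi(x,x)=0$ for all $x,y\in\Gamma$; (2) $\psi(x,z)\le\psi(x,y)+\psi(y,z)$ for all $x,y,z\in\Gamma$; (3) $\psi(sx,sy)=\psi(x,y)$ for all $x,y,s\in\Gamma$; (4) for any $d_0\in\mathcal{D}_\Gamma$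 and $C\ge0$ there exists $D\ge0$ such that for all $x,y,w\in\Gamma$ with $(x|y)_{w,d_0}\le C$ one has $(x|y)_{w,\psi}\le D$. For such $\psi$, $\ell_\psi[x]=\lim_{n\to\infty}\frac1n\psi(o,x^n)$ for $x\in\Gamma$, where $[x]$ is the conjugacy class of $x$, and $\mathbf{conj}$ is the set of conjugacy classes of $\Gamma$. The dilation is $\mathrm{Dil}(\psi,\psi_* )=\inf\{\lambda>0:\ell_\psi[x]\le\lambda\,\ell_{\psi_*}[x]\text{ for all }[x]\in\mathbf{conj}\}$, equal to $\infty$ if no such $\lambda$ exists. *)

(* Defs.v *)
From mathcomp Require Import all_boot all_order all_algebra.
From mathcomp Require Import all_classical all_reals all_analysis.

Set Implicit Arguments.
Unset Strict Implicit.
Unset Printing Implicit Defensive.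

Import Order.TTheory GRing.Theory Num.Theory.
Import numFieldNormedType.Exports.

Local Open Scope classical_set_scope.
Local Open Scope ring_scope.

Section GromovProduct.
Context {R : realType} {T : Type}.
Implicit Types psi d : T -> T -> R.

Definition gromov_product psi (w x y : T) : R :=
  (psi x w + psi w y - psi x y) / 2.

Record pseudo_metric d : Prop := {
  pseudo_metric_ge0 : forall x y, 0 <= d x y;
  pseudo_metric_refl : forall x, d x x = 0;
  pseudo_metric_sym : forall x y, d x y = d y x;
  pseudo_metric_triangle : forall x y z, d x z <= d x y + d y z }.

Definition gromov_hyperbolic d : Prop :=
  exists2 delta : R, 0 <= delta & forall x y z w,
    Num.min (gromov_product d z x w) (gromov_product d z w y) - delta
      <= gromov_product d z x y.

(* The identity is surjective, so no coarse density condition is needed. *)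
Definition id_quasi_isometry d d' : Prop :=
  exists a b : R, [/\ 1 <= a, 0 <= b & forall x y,
    a^-1 * d x y - b <= d' x y /\ d' x y <= a * d x y + b].

End GromovProduct.

Section Groups.
Context {G : groupType}.

Definition symmetric_generating (S : seq G) : Prop :=
  (forall s, s \in S -> (s^-1)%g \in S) /\
  (forall g : G, exists2 w : seq G, all (mem S) w & (\prod_(s <- w) s)%g = g).

Definition cyclic_subgroup (g : G) : set G :=
  [set x | exists n : nat, (x = g ^+ n)%g \/ (x = g ^- n)%g].

Definition finite_index (H : set G) : Prop :=
  finite_set (range (fun x : G => [set (x * h)%g | h in H])).

End Groups.

Definition virtually_cyclic (G : groupType) : Prop :=
  exists g : G, finite_index (cyclic_subgroup g).

Section Metrics.
Context {R : realType} {G : groupType}.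
Implicit Types psi d : G -> G -> R.

Definition left_invariant psi : Prop :=
  forall s x y : G, psi (s * x)%g (s * y)%g = psi x y.

Definition word_metric (S : seq G) (x y : G) : R :=
  inf [set (size w)%:R | w in
        [set w : seq G | all (mem S) w /\ (\prod_(s <- w) s = x^-1 * y)%g]].

(* The set of pseudo metrics denoted $\mathcal{D}_\Gamma$. *)
Record D_metric d : Prop := {
  D_metric_pseudo_metric : pseudo_metric d;
  D_metric_left_invariant : left_invariant d;
  D_metric_hyperbolic : gromov_hyperbolic d;
  D_metric_quasi_isometry : exists2 S : seq G,
    symmetric_generating S & id_quasi_isometry (word_metric S) d }.

Record hyperbolic_distance_like psi : Prop := {
  distance_like_ge0 : forall x y, 0 <= psi x y;
  distance_like_refl : forall x, psi x x = 0;
  distance_like_triangle : forall x y z, psi x z <= psi x y + psi y z;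
  distance_like_left_invariant : left_invariant psi;
  distance_like_gromov_product : forall d0, D_metric d0 ->
    forall C : R, 0 <= C -> exists2 D : R, 0 <= D &
      forall x y w, gromov_product d0 w x y <= C -> gromov_product psi w x y <= D }.

(* For psi left-invariant and subadditive, the limit exists by Fekete's lemma
   and depends only on the conjugacy class of x; quantifying over
   conjugacy classes is therefore quantifying over x. *)
Definition stable_length psi (x : G) : R :=
  limn (fun n : nat => n%:R^-1 * psi 1%g (x ^+ n)%g).

Definition Dil psi psi' : \bar R :=
  ereal_inf [set lambda%:E | lambda in
    [set lambda : R | 0 < lambda /\
       forall x : G, stable_length psi x <= lambda * stable_length psi' x]].

End Metrics.

Definition hyperbolic_group (R : realType) (G : groupType) : Prop :=
  exists2 S : seq G, symmetric_generating S &
    gromov_hyperbolic (word_metric S : G -> G -> R).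

(* Main.v *)
Require Import Defs.
From mathcomp Require Import all_boot all_order all_algebra.
From mathcomp Require Import all_classical all_reals all_analysis.
From mathcomp Require Import ring lra.

Set Implicit Arguments.
Unset Strict Implicit.

Import Order.TTheory GRing.Theory Num.Theory.
Import numFieldNormedType.Exports.

Local Open Scope classical_set_scope.
Local Open Scope ring_scope.

(** The stable length of an element y never exceeds psi(1,y).  The theorem holds
    because, up to moving the endpoint a bounded distance, the converse also holds
    with a bounded error: there is a constant C such that for every x some y
    satisfies psi_s(1,x) <= l_{psi_s}(y) + C and psi(1,y) <= psi(1,x) + C
    ([transverse_element]).  Then, with lambda the dilation,
    psi_s(1,x) <= l_{psi_s}(y) + C <= lambda l_psi(y) + C <= lambda psi(1,y) + C,
    and the last term is at most lambda psi(1,x) + (lambda + 1) C.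

    Let d be a hyperbolic word metric.  If (y^-1|y)_1 <= K and y is long compared
    with K and delta, the powers of y are consecutive vertices of a path with no
    sharp turn, so (1|y^(n+1)) based at y^n stays bounded
    ([transverse_power_gromov_product]).  The last axiom of distance-like functions
    transfers this to psi: the sequence psi(1,y^n) is additive up to a bounded
    error, hence psi(1,y) <= l_psi(y) + C ([stable_length_transverse]).

    It remains to correct an arbitrary x to y = x f^-1 with f bounded and
    (y^-1|y)_1 bounded, that is, to find f in a fixed ball with (x|f x^-1)_1
    bounded.  If no ball were sufficient, there would be, at every scale r, a point
    v such that every element of the ball of radius r moves v to a point in almost
    the same direction.  On that ball the function h(f) = d(f,v) - d(1,v) is then a
    quasimorphism with defect 2 delta ([busemann_quasimorphism]), and the number of
    elements with |h| <= B is bounded independently of r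
    ([almost_fixed_count]).  If h(g) is large, right multiplication by
    powers of g leads from any element to one of the same coset of <g> with h
    bounded, so <g> has finite index ([almost_fixed_virtually_cyclic]), contrary to the hypothesis that
    the group is non-elementary.  This is the boundary-free form of the fact that
    a hyperbolic group fixing a point at infinity is virtually cyclic.  All
    quantities are finite-scale, so no limit of the points v is taken. *)

(** * Subadditive sequences and stable length *)

Section Fekete.
Variables (R : realType) (a : nat -> R).
Hypothesis a_ge0 : forall n, 0 <= a n.
Hypothesis a_sub : forall m n, a (m + n)%N <= a m + a n.

Lemma subadditive_muln m n : a (m * n)%N <= m%:R * a n + a 0%N.
Proof.
elim: m => [|m IH]; first by rewrite mul0n mul0r add0r.
have := a_sub n (m * n)%N; rewrite mulSn -natr1; lra.
Qed.

(** Euclidean division of n by m + 1 bounds a n / n by a (m + 1) / (m + 1) plus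
    a term of order 1 / n, for each m; hence the limit is the infimum. *)
Lemma fekete : n%:R^-1 * a n @[n --> \oo] -->
  inf [set n.+1%:R^-1 * a n.+1 | n in [set: nat]].
Proof.
set E := [set _ | _ in _]; set L := inf E.
have lbE : has_lbound E.
  by exists 0 => _ [n _ <-]; rewrite mulr_ge0 ?invr_ge0.
have infE : has_inf E by split => //; exists (1%:R^-1 * a 1); exists 0.
apply/cvgrPdist_le => e e0.
have e20 : 0 < e / 2 by rewrite divr_gt0.
have [_ [m _ <-] Em] := inf_adherent e20 infE.
rewrite -/L in Em.
(* The last two terms absorb the values at 0 that subadditive_muln leaves for the
   quotient and for the remainder. *)
set c := m.+1%:R * a 1 + a 0%N + a 0%N.
have c0 : 0 <= c by rewrite !addr_ge0// mulr_ge0.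
exists (Num.bound (c / (e / 2))).+1 => // n /= Nn.
have n0 : 0 < n%:R :> R by rewrite ltr0n (leq_trans _ Nn).
have Lu : L <= n%:R^-1 * a n.
  by apply: ge_inf => //; exists n.-1; rewrite ?prednK -?(ltr0n R).
have cn : n%:R^-1 * c <= e / 2.
  rewrite mulrC ler_pdivrMr// mulrC -ler_pdivrMr//.
  have cb := archi_boundP (divr_ge0 c0 (ltW e20)).
  by rewrite (le_trans (ltW cb))// ler_nat (leq_trans _ Nn).
have ub : a n <= n%:R * (m.+1%:R^-1 * a m.+1) + c.
  have qle : (n %/ m.+1)%:R * a m.+1 <= n%:R * (m.+1%:R^-1 * a m.+1).
    rewrite mulrA ler_wpM2r// ler_pdivlMr//.
    by rewrite -natrM ler_nat leq_divM.
  have rle : (n %% m.+1)%:R * a 1 <= m.+1%:R * a 1.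
    by rewrite ler_wpM2r// ler_nat ltnW// ltn_pmod.
  have an := a_sub (n %/ m.+1 * m.+1) (n %% m.+1); rewrite -divn_eq in an.
  have aq := subadditive_muln (n %/ m.+1) m.+1.
  have ar := subadditive_muln (n %% m.+1) 1; rewrite muln1 in ar.
  rewrite (le_trans an)// (le_trans (lerD aq ar))// /c -!addrA.
  move: qle rle; set s := _ * (_ * _); set t := _ * _; set u := _ * _;
    set w := _ * _; move: s t u w (a 0) => s t u w z; lra.
have : n%:R^-1 * a n <= m.+1%:R^-1 * a m.+1 + n%:R^-1 * c.
  by rewrite mulrC ler_pdivrMr// mulrDl [X in _ + X]mulrAC mulVf ?gt_eqF// mul1r mulrC.
rewrite distrC ger0_norm ?subr_ge0// lerBlDl => /le_trans; apply.
by rewrite (le_trans (lerD (ltW Em) cn))// -addrA -splitr.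
Qed.

End Fekete.

Section StableLength.
Variables (R : realType) (G : groupType) (psi : G -> G -> R).
Hypothesis psi_dl : hyperbolic_distance_like psi.

Lemma distance_like_translate x y : psi x y = psi 1%g (x^-1 * y)%g.
Proof.
by rewrite -(distance_like_left_invariant psi_dl x^-1%g) mulVg.
Qed.

(** As an infimum the stable length has the bounds needed below without any
    further discussion of convergence. *)
Lemma stable_length_inf x : stable_length psi x =
  inf [set n.+1%:R^-1 * psi 1%g (x ^+ n.+1)%g | n in [set: nat]].
Proof.
apply: cvg_lim => //; apply: (@fekete _ (fun n => psi 1%g (x ^+ n)%g)).
  by move=> n; apply: distance_like_ge0.
move=> m n; rewrite (le_trans (distance_like_triangle psi_dl _ (x ^+ m)%g _))//.
by rewrite lerD2l [leLHS]distance_like_translate expgnDr mulKg.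
Qed.

Lemma stable_length_ge0 x : 0 <= stable_length psi x.
Proof.
rewrite stable_length_inf; apply: lb_le_inf.
  by exists (1%:R^-1 * psi 1%g (x ^+ 1)%g); exists 0.
by move=> _ [n _ <-]; rewrite mulr_ge0 ?invr_ge0// (distance_like_ge0 psi_dl).
Qed.

Lemma stable_length_le x : stable_length psi x <= psi 1%g x.
Proof.
rewrite stable_length_inf; apply: ge_inf; last first.
  by exists 0 => //; rewrite invr1 mul1r.
exists 0 => _ [n _ <-].
by rewrite mulr_ge0 ?invr_ge0// (distance_like_ge0 psi_dl).
Qed.

(** Almost superadditivity along the powers of x gives
    n (psi(1,x) - D) <= psi(1,x^n) by induction. *)
Lemma stable_length_ge x D :
    (forall n, psi 1%g (x ^+ n)%g + psi 1%g x - D <= psi 1%g (x ^+ n.+1)%g) ->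
  psi 1%g x - D <= stable_length psi x.
Proof.
move=> xD; rewrite stable_length_inf; apply: lb_le_inf.
  by exists (1%:R^-1 * psi 1%g (x ^+ 1)%g); exists 0.
have lin n : n%:R * (psi 1%g x - D) <= psi 1%g (x ^+ n)%g.
  elim: n => [|n IH]; first by rewrite mul0r (distance_like_ge0 psi_dl).
  by have := xD n; rewrite -natr1; lra.
by move=> _ [n _ <-]; rewrite mulrC ler_pdivlMr// mulrC.
Qed.

End StableLength.

(** The infimum defining a finite dilation is attained, except that it may be 0,
    because stable lengths are nonnegative. *)
Lemma Dil_finite (R : realType) (G : groupType) (psi psi' : G -> G -> R) :
    hyperbolic_distance_like psi' -> (Dil psi psi' < +oo)%E ->
  exists lam : R, [/\ 0 <= lam, Dil psi psi' = lam%:E &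
    forall x, stable_length psi x <= lam * stable_length psi' x].
Proof.
move=> psi'_dl Dil_oo.
have Dil0 : (0 <= Dil psi psi')%E.
  by apply: le_ereal_inf_tmp => _ [t [t0 _] <-]; rewrite lee_fin ltW.
have Dil_fin : Dil psi psi' \is a fin_num by rewrite ge0_fin_numE.
exists (fine (Dil psi psi')); split; [exact: fine_ge0|by rewrite fineK|move=> x].
have l0 := stable_length_ge0 psi'_dl x.
apply/ler_addgt0Pr => e e0.
pose e' := e / (stable_length psi' x + 1).
have l1 : 0 < stable_length psi' x + 1 by rewrite ltr_wpDl.
have e'0 : 0 < e' by rewrite divr_gt0.
have [_ [t [t0 tP] <-]] := lb_ereal_inf_adherent e'0 Dil_fin.
rewrite -/(Dil psi psi') -(fineK Dil_fin) -EFinD lte_fin fineK// => te.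
apply: (le_trans (tP x)); apply: (le_trans (ler_wpM2r l0 (ltW te))).
rewrite mulrDl lerD2l mulrAC ler_pdivrMr// mulrDr mulr1.
by rewrite lerDl ltW.
Qed.

(** * Word metrics *)

Section WordMetric.
Variables (R : realType) (G : groupType) (S : seq G).
Hypothesis S_gen : symmetric_generating S.

Local Notation d := (word_metric S : G -> G -> R).

Lemma word_metric_le (w : seq G) x y :
  all (mem S) w -> (\prod_(s <- w) s)%g = (x^-1 * y)%g ->
  d x y <= (size w)%:R.
Proof.
move=> wS wE; apply: ge_inf; last by exists w.
by exists 0 => _ [u _ <-].
Qed.

Lemma word_metric_attained x y : exists w : seq G,
  [/\ all (mem S) w, (\prod_(s <- w) s)%g = (x^-1 * y)%g &
      d x y = (size w)%:R].
Proof.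
pose P n := `[< exists w : seq G, [/\ all (mem S) w,
  (\prod_(s <- w) s)%g = (x^-1 * y)%g & size w = n] >].
have exP : exists n, P n.
  by have [w wS wE] := S_gen.2 (x^-1 * y)%g; exists (size w); apply/asboolP; exists w.
have [_ /asboolP[w [wS wE <-]] w_min] := ex_minnP exP.
exists w; split => //; apply/eqP; rewrite eq_le word_metric_le//=.
apply: lb_le_inf; first by exists (size w)%:R, w.
move=> _ [u [uS uE] <-]; rewrite ler_nat w_min//.
by apply/asboolP; exists u.
Qed.

Lemma word_metric_left_invariant : left_invariant d.
Proof.
move=> s x y; rewrite /word_metric.
by rewrite (_ : (s * x)^-1 * (s * y) = x^-1 * y)%g// invgM -mulgA mulKg.
Qed.

Lemma word_metric_pseudo_metric : pseudo_metric d.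
Proof.
have dsym x y : d x y <= d y x.
  have [w [wS wE ->]] := word_metric_attained y x.
  rewrite -(size_map (fun s : G => s^-1%g)) -size_rev; apply: word_metric_le.
    rewrite all_rev all_map; apply: sub_all wS => s.
    by rewrite /= => /(S_gen.1 s).
  rewrite -[RHS]invgK invgM invgK -wE.
  elim: w {wS wE} => [|s w IH]; first by rewrite /= !big_nil invg1.
  by rewrite /= rev_cons -cats1 big_cat/= big_cons big_nil mulg1 big_cons invgM IH.
split.
- by move=> x y; have [w [_ _ ->]] := word_metric_attained x y.
- move=> x; apply/eqP; rewrite eq_le (@word_metric_le [::])//= ?big_nil ?mulVg//.
  by have [w [_ _ ->]] := word_metric_attained x x.
- by move=> x y; apply/eqP; rewrite eq_le !dsym.
- move=> x y z; have [u [uS uE ->]] := word_metric_attained x y.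
  have [w [wS wE ->]] := word_metric_attained y z.
  rewrite -natrD -size_cat; apply: word_metric_le; first by rewrite all_cat uS.
  by rewrite big_cat/= uE wE mulgA mulgK.
Qed.

(** The point p is the value of a prefix of length t of a shortest word for v. *)
Lemma word_metric_geodesic v (t : nat) : t%:R <= d 1%g v ->
  exists p, d 1%g p = t%:R /\ d p v = d 1%g v - t%:R.
Proof.
have [w [wS wE wd]] := word_metric_attained 1%g v.
rewrite wd ler_nat => tw; exists (\prod_(s <- take t w) s)%g.
move: wS wE; rewrite -{1 2}(cat_take_drop t w) all_cat big_cat invg1 mul1g/=.
set p := (\prod_(s <- take t w) s)%g => /andP[pS qS] pq.
have le1 : d 1%g p <= t%:R.
  by rewrite -(size_takel tw); apply: word_metric_le; rewrite ?invg1 ?mul1g.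
have le2 : d p v <= (size w)%:R - t%:R.
  by rewrite -natrB// -size_drop; apply: word_metric_le; rewrite // -pq mulKg.
have := pseudo_metric_triangle word_metric_pseudo_metric 1%g p v.
by rewrite wd => ge3; split; apply/eqP; rewrite eq_le ?le1 ?le2 /=; lra.
Qed.

Lemma word_metric_ball_finite (r : R) :
  exists l : seq G, forall g, d 1%g g <= r -> g \in l.
Proof.
(* W n lists the values of all words of length n. *)
pose W := fix W n := if n is n'.+1 then [seq s * g | s <- S, g <- W n']%g
                     else [:: 1%g].
have prodW w : all (mem S) w -> (\prod_(s <- w) s)%g \in W (size w).
  elim: w => [|s w IH]; first by rewrite big_nil mem_head.
  by move=> /= /andP[sS /IH wW]; rewrite big_cons; apply: allpairs_f.
exists (flatten [seq W n | n <- iota 0 (Num.bound r).+1]) => g gr.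
have [w [wS wE wd]] := word_metric_attained 1%g g.
move: wE; rewrite invg1 mul1g => <-.
apply/flatten_mapP; exists (size w); last exact: prodW.
rewrite mem_iota /= add0n ltnS -(ler_nat R) -wd (le_trans gr)//.
rewrite ltW//; apply: archi_boundP; apply: le_trans gr; rewrite wd//.
Qed.

Lemma word_metric_D_metric : gromov_hyperbolic d -> D_metric d.
Proof.
move=> dhyp; split => //.
- exact: word_metric_pseudo_metric.
- exact: word_metric_left_invariant.
- exists S => //; exists 1, 0; split => // x y.
  by rewrite invr1 !mul1r subr0 addr0.
Qed.

End WordMetric.

(** * Finite sequences and cosets of a cyclic subgroup *)

Section FiniteSequences.
Variables (R : realType) (T : eqType).

Lemma seq_bound (s : seq T) (F : T -> R) :
  exists n : nat, forall x, x \in s -> F x <= n%:R.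
Proof.
elim: s => [|a s [n nP]]; first by exists 0%N.
exists (maxn n (Num.bound `|F a|)) => x; rewrite inE => /orP[/eqP->|/nP xn].
  rewrite (le_trans (ler_norm _))// (le_trans (ltW (archi_boundP _)))//.
  by rewrite ler_nat leq_maxr.
by rewrite (le_trans xn)// ler_nat leq_maxl.
Qed.

(** Used to fix one group element that works at all scales r, when a finite list
    contains at each scale one that works. *)
Lemma seq_pigeonhole (s : seq T) (P : T -> R -> Prop) :
    (forall x r r', r <= r' -> P x r' -> P x r) ->
    (forall r, exists2 x, x \in s & P x r) ->
  exists2 x, x \in s & forall r, P x r.
Proof.
move=> Pmono; elim: s => [|a s IH] sP; first by have [] := sP 0.
have [aP|/existsNP[ra naP]] := pselect (forall r, P a r).
  by exists a => //; rewrite mem_head.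
have [|x xs xP] := IH; last by exists x => //; rewrite inE xs orbT.
move=> r; have [x] := sP (Num.max r ra); rewrite inE => /orP[/eqP-> Pa|xs Px].
  by case: naP; apply: Pmono Pa; rewrite le_max lexx orbT.
by exists x => //; apply: Pmono Px; rewrite le_max lexx.
Qed.

End FiniteSequences.

Lemma uniq_seq_of_infinite (T : eqType) (n : nat) :
    ~ (exists s : seq T, forall x, x \in s) ->
  exists2 s : seq T, uniq s & size s = n.
Proof.
move=> infT; elim: n => [|n [s s_uniq sn]]; first by exists [::].
have /existsNP[x xs] : ~ (forall x, x \in s) by move=> sT; apply: infT; exists s.
by exists (x :: s); rewrite /= ?sn// s_uniq andbT; apply/negP.
Qed.

Section Cosets.
Variables (G : groupType) (g : G).

Definition cycle_coset (x : G) : set G := [set (x * h)%g | h in cyclic_subgroup g].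

Lemma cyclic_subgroup_mul h : cyclic_subgroup g h ->
  cyclic_subgroup g (g * h)%g /\ cyclic_subgroup g (g^-1 * h)%g.
Proof.
have exp n : cyclic_subgroup g (g ^+ n)%g by exists n; left.
have expV n : cyclic_subgroup g (g ^- n)%g by exists n; right.
case=> -[|n] [] ->; rewrite ?expg0 ?invg1 ?mulg1.
- by split; [exact: (exp 1%N)|exact: (expV 1%N)].
- by split; [exact: (exp 1%N)|exact: (expV 1%N)].
- by split; [rewrite -expgS; exact: exp|rewrite expgS mulKg; exact: exp].
- split; first by rewrite expgSr invgM mulVKg; exact: expV.
  by rewrite -invgM -expgSr; exact: expV.
Qed.

Lemma cycle_coset_mulr z : cycle_coset (z * g)%g = cycle_coset z.
Proof.
apply/seteqP; split=> _ [h /cyclic_subgroup_mul[gh gVh] <-].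
  by exists (g * h)%g => //; rewrite mulgA.
by exists (g^-1 * h)%g => //; rewrite -mulgA mulVKg.
Qed.

Lemma cycle_coset_mulrV z : cycle_coset (z * g^-1)%g = cycle_coset z.
Proof. by rewrite -cycle_coset_mulr mulgVK. Qed.

End Cosets.

Arguments cycle_coset {G} g x.

(** * Almost fixed directions in a hyperbolic group *)

Section Hyperbolic.
Variables (R : realType) (G : groupType) (d : G -> G -> R) (delta : R).
Hypothesis d_pm : pseudo_metric d.
Hypothesis d_inv : left_invariant d.
Hypothesis delta_ge0 : 0 <= delta.
Hypothesis d_hyp : forall x y z w,
  Num.min (gromov_product d z x w) (gromov_product d z w y) - delta
    <= gromov_product d z x y.

Local Notation len := (d 1%g).
Local Notation gp := (gromov_product d).

Let d_sym := pseudo_metric_sym d_pm.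
Let d_tri := pseudo_metric_triangle d_pm.
Let d_refl := pseudo_metric_refl d_pm.
Let d_ge0 := pseudo_metric_ge0 d_pm.

Lemma gromov_hyp_or x y z w :
  gp z x w - delta <= gp z x y \/ gp z w y - delta <= gp z x y.
Proof.
by have := d_hyp x y z w; rewrite lerBlDr ge_min -!lerBlDr => /orP.
Qed.

Lemma len_inv x : len x^-1%g = len x.
Proof. by rewrite -(d_inv x) mulg1 mulgV d_sym. Qed.

Lemma len_mul x y : len (x * y)%g <= len x + len y.
Proof. by rewrite (le_trans (d_tri _ x _))// -{2}(mulg1 x) d_inv. Qed.

Lemma gromov_product_translate s x y z :
  gp (s * z)%g (s * x)%g (s * y)%g = gp z x y.
Proof. by rewrite /gromov_product !d_inv. Qed.

(** For v far away this approximates, up to O(delta), the Busemann function of the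
    direction of v, normalized at 1. *)
Definition busemann (v f : G) : R := d f v - len v.

(** The finite-scale version of a point at infinity fixed by the whole group. *)
Definition almost_fixed (r : R) (v : G) : Prop :=
  forall f, len f <= r -> r <= gp 1%g (f * v)%g v.

Lemma busemann_le_len v f : `|busemann v f| <= len f.
Proof.
rewrite ler_norml /busemann; have := d_tri 1%g f v; have := d_tri f 1%g v.
by rewrite (d_sym f 1%g) => *; apply/andP; split; lra.
Qed.

(** Busemann functions see only the direction: (g|v)_1 = (len g - busemann v g)/2,
    and (g|v)_1, (g|w)_1 agree up to delta when (w|v)_1 is at least len g, which
    bounds both of them. *)
Lemma busemann_close v w g : len g <= gp 1%g w v ->
  `|busemann v g - busemann w g| <= 2 * delta.
Proof.
have := gromov_hyp_or g v 1%g w; have := gromov_hyp_or g w 1%g v.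
have := d_tri 1%g g v; have := d_tri 1%g g w.
rewrite /busemann /gromov_product ler_norml (d_sym v 1%g) (d_sym w 1%g).
rewrite (d_sym g 1%g) (d_sym w v).
have := delta_ge0.
by move=> ? ? ? [?|?] [?|?] ?; apply/andP; split; lra.
Qed.

(** d(fg,v) - d(f,v) is the Busemann function of f^-1 v at g, and f^-1 v has almost
    the same direction as v. *)
Lemma busemann_quasimorphism r v f g : almost_fixed r v ->
  len f <= r -> len g <= r ->
  `|busemann v (f * g)%g - busemann v f - busemann v g| <= 2 * delta.
Proof.
move=> vr fr gr.
have fv : len g <= gp 1%g (f^-1 * v)%g v.
  by apply: le_trans (vr _ _) => //; rewrite len_inv.
have := busemann_close fv; rewrite distrC /busemann.
rewrite -(d_inv f g) mulVKg -(d_inv f 1%g) mulVKg mulg1.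
by rewrite (_ : d (f * g)%g v - len v - (d f v - len v) = d (f * g)%g v - d f v)//; ring.
Qed.

Lemma almost_fixed_le r r' v : r <= r' -> almost_fixed r' v -> almost_fixed r v.
Proof.
by move=> rr vr f fr; rewrite (le_trans rr)// vr// (le_trans fr).
Qed.

Hypothesis d_geod : forall v (t : nat), t%:R <= len v ->
  exists p, len p = t%:R /\ d p v = len v - t%:R.

(** A geodesic from 1 to v and its translate by f, which points in the same
    direction, have merged up to O(B + delta) at distance t >= len f from their
    origins.  Since p and f p are the points at distance t on the two, and their
    distances to v differ by at most B + 2 delta, f moves p by a bounded amount. *)
Lemma almost_fixed_conj r (t : nat) v p f B : t%:R <= r -> almost_fixed r v ->
    len p = t%:R -> d p v = len v - t%:R ->
    len f <= t%:R -> `|busemann v f| <= B ->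
  len (p^-1 * f * p)%g <= 3 * B + 8 * delta.
Proof.
move=> tr vr pt pv ft fB.
rewrite -(d_inv p) mulg1 !mulgA mulgV mul1g.
have := @busemann_quasimorphism _ _ f p vr (le_trans ft tr).
rewrite pt => /(_ tr); move: fB; rewrite /busemann !ler_norml pv.
(* Seen from v, compare p with f p through the chain p, 1, f, f p. *)
have := gromov_hyp_or p (f * p)%g v 1%g.
have := gromov_hyp_or 1%g (f * p)%g v f.
have fpt : d f (f * p)%g = t%:R by rewrite -{1}(mulg1 f) d_inv.
rewrite /gromov_product fpt.
rewrite !(d_sym v) (d_sym p 1%g) ?pt ?pv.
have := delta_ge0; have : 0 <= t%:R :> R by [].
by move=> ? ? [?|?] [?|?] /andP[? ?] /andP[? ?]; lra.
Qed.

(** Conjugation by p is injective and, by the previous lemma, sends s into a ball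
    whose radius depends on neither t nor r. *)
Lemma almost_fixed_count r (t : nat) v (s l : seq G) B :
    t%:R <= r -> almost_fixed r v -> uniq s ->
    (forall f, f \in s -> len f <= t%:R /\ `|busemann v f| <= B) ->
    (forall f, len f <= 3 * B + 8 * delta -> f \in l) ->
  (size s <= size l)%N.
Proof.
move=> tr vr s_uniq sB lP.
have [|p [pt pv]] := @d_geod v t.
  have := vr 1%g; rewrite d_refl mul1g /gromov_product d_refl d_sym.
  by move=> /(_ (le_trans (ler0n _ _) tr)); lra.
rewrite -(size_map (fun f => p^-1 * f * p)%g); apply: uniq_leq_size.
  by rewrite map_inj_uniq// => f f' /mulIg/mulgI.
by move=> _ /mapP[f /sB[ft fB] ->]; apply/lP/(almost_fixed_conj tr vr pt pv).
Qed.

(** Right multiplication by g changes the Busemann function by busemann v g up to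
    2 delta, thus by at least 1, and by at most len g + 2 delta; so multiplying by
    g or its inverse lowers the absolute value by 1 as long as it is above
    len g + 2 delta. *)
Lemma coset_walk r v g (m : nat) z : almost_fixed r v ->
    2 * delta + 1 <= `|busemann v g| ->
    len z + m%:R * len g <= r -> len g <= r ->
    `|busemann v z| <= len g + 2 * delta + m%:R ->
  exists z', [/\ cycle_coset g z' = cycle_coset g z,
    len z' <= len z + m%:R * len g &
    `|busemann v z'| <= len g + 2 * delta].
Proof.
move=> vr hg + gr; elim: m z => [|m IH] z.
  by rewrite addr0 => _ hz; exists z; split; rewrite ?lerDl ?mulr_ge0.
rewrite -natr1 mulrDl mul1r => zr hz.
have mg0 : 0 <= m%:R * len g by rewrite mulr_ge0.
have g0 : 0 <= len g by [].
have [small|big] := lerP `|busemann v z| (len g + 2 * delta + m%:R).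
  have [|z' [z'z z'l z'h]] := IH _ _ small; first by lra.
  by exists z'; split => //; lra.
suff [z1 [z1z z1l z1h]] : exists z1, [/\ cycle_coset g z1 = cycle_coset g z,
    len z1 <= len z + len g & `|busemann v z1| <= `|busemann v z| - 1].
  have [||z' [z'z z'l z'h]] := IH z1; [lra|lra|].
  by exists z'; split => //; [rewrite z'z|lra].
have zg : len (z * g)%g <= len z + len g by exact: len_mul.
have zgV : len (z * g^-1)%g <= len z + len g by rewrite -(len_inv g) len_mul.
have hgl := busemann_le_len v g.
have m0 : 0 <= m%:R :> R by [].
have zr' : len z <= r by lra.
have qm := busemann_quasimorphism vr zr' gr.
have zgVr : len (z * g^-1)%g <= r by lra.
have qmV := busemann_quasimorphism vr zgVr gr.
rewrite mulgVK in qmV.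
(* Multiply by g when the two Busemann values have opposite signs, and by its
   inverse otherwise. *)
have [opp|same] := boolP ((0 <= busemann v z) == (busemann v g < 0)).
- exists (z * g)%g; split; rewrite ?cycle_coset_mulr//.
  move: opp qm big hg hgl; rewrite !ler_norml.
  have [hz0|hz0] := lerP 0 (busemann v z); have [hg0|hg0] := ltrP (busemann v g) 0;
    rewrite ?(ger0_norm hz0) ?(ler0_norm (ltW hz0)) ?(ger0_norm hg0)
      ?(ler0_norm (ltW hg0)) //= => _ /andP[? ?] ? ? /andP[? ?]; apply/andP; split; lra.
- exists (z * g^-1)%g; split; rewrite ?cycle_coset_mulrV//.
  move: same qmV big hg hgl; rewrite !ler_norml.
  have [hz0|hz0] := lerP 0 (busemann v z); have [hg0|hg0] := ltrP (busemann v g) 0;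
    rewrite ?(ger0_norm hz0) ?(ler0_norm (ltW hz0)) ?(ger0_norm hg0)
      ?(ler0_norm (ltW hg0)) //= => _ /andP[? ?] ? ? /andP[? ?]; apply/andP; split; lra.
Qed.

Hypothesis d_ball : forall r, exists l : seq G, forall f, len f <= r -> f \in l.

(** Few elements can have a small Busemann value, so any sufficiently long list
    contains one with a large value; the list can be chosen before the scale. *)
Lemma almost_fixed_large_busemann :
    (forall r, exists v, almost_fixed r v) ->
    ~ (exists s : seq G, forall f, f \in s) ->
  exists g, forall r, exists2 v, almost_fixed r v &
    2 * delta + 1 <= `|busemann v g|.
Proof.
move=> fixr infG.
have [l lP] := d_ball (3 * (2 * delta + 1) + 8 * delta).
have [s s_uniq sl] := uniq_seq_of_infinite (size l).+1 infG.
have [t st] := seq_bound s len.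
suff [g _ gP] : exists2 g, g \in s & forall r, exists2 v, almost_fixed r v &
    2 * delta + 1 <= `|busemann v g| by exists g.
apply: seq_pigeonhole => [f r r' rr' [v vr' hv]|r].
  by exists v => //; apply: almost_fixed_le vr'.
have [v vr] := fixr (Num.max r t%:R).
apply: contrapT => noP; suff : (size s <= size l)%N by rewrite sl ltnn.
apply: (almost_fixed_count (r := Num.max r t%:R) (t := t) (v := v)) lP => //.
  by rewrite le_max lexx orbT.
move=> f fs; split; first exact: st.
apply: contra_notT noP; rewrite -ltNge => /ltW hf; exists f => //; exists v => //.
by apply: almost_fixed_le vr; rewrite le_max lexx.
Qed.

(** Given too many left cosets of <g>, pick a scale at which all their
    representatives, and the walks that lower their Busemann values, are visible;
    the endpoints of these walks contradict almost_fixed_count. *)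
Lemma almost_fixed_virtually_cyclic :
  (forall r, exists v, almost_fixed r v) -> virtually_cyclic G.
Proof.
move=> fixr.
have [[s sG]|infG] := pselect (exists s : seq G, forall f, f \in s).
  (* A finite group has the trivial subgroup as a subgroup of finite index. *)
  exists 1%g; apply: finite_image.
  by apply: (sub_finite_set _ (finite_seq s)) => x _; exact: sG.
have [g gP] := almost_fixed_large_busemann fixr infG.
exists g; apply: contrapT => infC.
pose A := len g + 2 * delta.
have [l lP] := d_ball (3 * A + 8 * delta).
have [B BC lB] := infinite_set_fset (size l).+1 infC.
pose cs := finmap.enum_fset B.
have repB c : exists x, c \in cs -> cycle_coset g x = c.
  have [cB|] := boolP (c \in cs); last by exists 1%g.
  by have [x _ xc] := BC _ cB; exists x.
have [rep repP] := choice repB.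
have [m repm] := seq_bound cs (fun c => len (rep c)).
(* Representatives have length at most m, hence Busemann values at most m, so each
   walk takes at most m steps. *)
pose t := Num.bound (m%:R + m.+1%:R * len g).
have mg0 : 0 <= m%:R + m.+1%:R * len g by rewrite addr_ge0// mulr_ge0.
have mt : m%:R + m.+1%:R * len g <= t%:R by rewrite ltW// archi_boundP.
have [v vt hv] := gP t%:R.
have zB c : exists z, c \in cs -> [/\ cycle_coset g z = c, len z <= t%:R &
    `|busemann v z| <= A].
  have [cB|] := boolP (c \in cs); last by exists 1%g.
  have rm := repm _ cB; have rh := busemann_le_len v (rep c).
  have g0 : 0 <= len g by [].
  have m0 : 0 <= m%:R * len g by rewrite mulr_ge0.
  move: mt; rewrite -natr1 mulrDl mul1r => mt.
  have [|||z [zc zl zh]] := @coset_walk _ _ _ m (rep c) vt hv.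
  - lra.
  - by have : 0 <= m%:R :> R by []; lra.
  - by have := delta_ge0; lra.
  - exists z => _; split => //; first by rewrite zc repP.
    lra.
have [z zP] := choice zB.
suff : (size [seq z c | c <- cs] <= size l)%N.
  by rewrite size_map leqNgt lB.
apply: (almost_fixed_count (r := t%:R) (t := t) (v := v)) lP => //.
  rewrite map_inj_in_uniq ?finmap.fset_uniq// => c c' cB cB' zz.
  by have [<- _ _] := zP c cB; have [<- _ _] := zP c' cB'; rewrite zz.
by move=> _ /mapP[c cB ->]; have [] := zP c cB.
Qed.

Lemma gromov_productC x y z : gp z x y = gp z y x.
Proof.
by rewrite /gromov_product (d_sym y z) (d_sym z x) (d_sym y x) (addrC (d z y)).
Qed.

(** If f v stays in the direction of u for every short f, then it stays in the
    direction of v, since f = 1 is allowed. *)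
Lemma transverse_translate : ~ virtually_cyclic G ->
  exists r K, forall u v, exists2 f, len f <= r & gp 1%g u (f * v)%g <= K.
Proof.
move=> nvc; apply: contrapT => nP; apply: nvc.
apply: almost_fixed_virtually_cyclic => r.
apply: contrapT => nv; apply: nP.
have [r0|r0] := ltrP r 0.
  case: nv; exists 1%g => f fr.
  by have := d_ge0 1%g f; lra.
exists r, (r + delta) => u v; apply: contrapT => nf; apply: nv; exists v => f fr.
have uf h : len h <= r -> r + delta < gp 1%g u (h * v)%g.
  by move=> hr; rewrite ltNge; apply/negP => ?; apply: nf; exists h.
have := uf f fr; have := uf 1%g; rewrite d_refl mul1g => /(_ r0) ? ?.
by have := gromov_hyp_or (f * v)%g v 1%g u; rewrite gromov_productC => -[?|?]; lra.
Qed.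

Lemma gromov_product_perturb x f z : gp 1%g ( x * f)%g z <= gp 1%g x z + len f.
Proof.
have := d_tri x (x * f)%g z; have := d_tri (x * f)%g x 1%g.
have := d_inv x 1%g f; rewrite mulg1 /gromov_product => <-.
by rewrite (d_sym (x * f)%g x); lra.
Qed.

(** A local-to-global argument.  Translating by a power of y, the claim is that
    (y^-n|y)_1 <= K + delta.  If it holds for n, then
    (y^-1|y^-(n+1))_1 = len y - (y^-n|y)_1 > K + delta; as (y^-1|y)_1 <= K, the
    hyperbolic inequality leaves only (y^-(n+1)|y)_1 <= K + delta. *)
Lemma transverse_power_gromov_product y K : gp 1%g y^-1%g y <= K ->
    2 * K + 2 * delta < len y ->
  forall n, gp (y ^+ n)%g 1%g (y ^+ n.+1)%g <= K + delta.
Proof.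
move=> yK yl n.
have K0 : 0 <= K.
  apply: le_trans yK; rewrite /gromov_product.
  by have := d_tri y^-1%g 1%g y; lra.
have -> : gp (y ^+ n)%g 1%g (y ^+ n.+1)%g = gp 1%g (y ^- n)%g y.
  by rewrite -(gromov_product_translate (y ^- n)%g) mulg1 expgSr mulKg mulVg.
elim: n => [|n IH].
  rewrite expg0 invg1 /gromov_product d_refl.
  by have := delta_ge0; lra.
have [|//] := gromov_hyp_or y^-1%g y 1%g (y ^- n.+1)%g; last by lra.
have : gp 1%g y^-1%g (y ^- n.+1)%g = len y - gp 1%g (y ^- n)%g y.
  rewrite -(gromov_product_translate y) mulgV mulg1 expgSr invgM mulVKg.
  rewrite /gromov_product ?(d_sym y) ?(d_sym _ 1%g).
  by field.
lra.
Qed.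

End Hyperbolic.

(** * Comparison of distance-like functions with stable lengths *)

Section Comparison.
Variables (R : realType) (G : groupType) (S : seq G) (delta : R).
Hypothesis S_gen : symmetric_generating S.
Local Notation d := (word_metric S : G -> G -> R).
Hypothesis delta_ge0 : 0 <= delta.
Hypothesis d_hyp : forall x y z w,
  Num.min (gromov_product d z x w) (gromov_product d z w y) - delta
    <= gromov_product d z x y.

Lemma distance_like_ball_bounded (psi : G -> G -> R) (r : R) :
  exists M : nat, forall f, d 1%g f <= r -> psi 1%g f <= M%:R.
Proof.
have [l lP] := word_metric_ball_finite S_gen r.
have [M MP] := seq_bound l (psi 1%g).
by exists M => f /lP/MP.
Qed.

(** Elements of length at most 2 K + 2 delta, for which the powers of y may turn
    back, form a finite set and only affect the constant. *)
Lemma stable_length_transverse (psi : G -> G -> R) (K : R) :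
    hyperbolic_distance_like psi -> 0 <= K ->
  exists C, forall y, gromov_product d 1%g y^-1%g y <= K ->
    psi 1%g y <= stable_length psi y + C.
Proof.
move=> psi_dl K0.
have d_pm := @word_metric_pseudo_metric R G S S_gen.
have d_inv := @word_metric_left_invariant R G S.
have d_D : D_metric d.
  by apply: word_metric_D_metric => //; exists delta.
have [D D0 DP] := distance_like_gromov_product psi_dl d_D (addr_ge0 K0 delta_ge0).
have [M MP] := distance_like_ball_bounded psi (2 * K + 2 * delta).
exists (M%:R + 2 * D) => y yK.
have M0 : 0 <= M%:R :> R by [].
have [/MP short|long] := lerP (d 1%g y) (2 * K + 2 * delta).
  by have := stable_length_ge0 psi_dl y; lra.
suff : psi 1%g y - 2 * D <= stable_length psi y by lra.
apply: stable_length_ge => // n.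
have := DP _ _ _ (transverse_power_gromov_product d_pm d_inv delta_ge0
  d_hyp yK long n).
rewrite /gromov_product (distance_like_translate psi_dl (y ^+ n)%g) expgSr mulKg.
by lra.
Qed.

(** The same y = x f^-1 serves both functions, because the condition on f involves
    only the word metric. *)
Lemma transverse_element (psi psi_s : G -> G -> R) :
    ~ virtually_cyclic G ->
    hyperbolic_distance_like psi -> hyperbolic_distance_like psi_s ->
  exists C, forall x, exists y, [/\ psi 1%g y <= psi 1%g x + C &
    psi_s 1%g x <= stable_length psi_s y + C].
Proof.
move=> nvc psi_dl psi_s_dl.
have d_pm := @word_metric_pseudo_metric R G S S_gen.
have d_inv := @word_metric_left_invariant R G S.
have [r [K rK]] := transverse_translate d_pm d_inv delta_ge0 d_hyp
  (word_metric_geodesic S_gen) (word_metric_ball_finite S_gen) nvc.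
have [C CP] := stable_length_transverse psi_s_dl
  (addr_ge0 (normr_ge0 K) (normr_ge0 r)).
have [M MP] := distance_like_ball_bounded psi r.
have [M' MP'] := distance_like_ball_bounded psi_s r.
exists (M%:R + (M'%:R + `|C|)) => x.
have [f fr xf] := rK x x^-1%g; have fVr : d 1%g f^-1%g <= r by rewrite len_inv.
exists (x * f^-1)%g; split.
  have := distance_like_triangle psi_dl 1%g x (x * f^-1)%g.
  rewrite (distance_like_translate psi_dl x) mulKg.
  by have := MP _ fVr; have : 0 <= M'%:R :> R by []; have := normr_ge0 C; lra.
have := distance_like_triangle psi_s_dl 1%g (x * f^-1)%g x.
rewrite (distance_like_translate psi_s_dl (x * f^-1)%g) invgM invgK mulgVK.
have := CP (x * f^-1)%g; rewrite (gromov_productC d_pm) invgM invgK.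
have := gromov_product_perturb d_pm d_inv x f^-1%g (f * x^-1)%g.
move=> p1 p2; have /p2 : gromov_product d 1%g (x * f^-1)%g (f * x^-1)%g <= `|K| + `|r|.
  by have := ler_norm K; have := ler_norm r; lra.
by have := MP' _ fr; have : 0 <= M%:R :> R by []; have := ler_norm C; lra.
Qed.

End Comparison.

Theorem theorem3p8 (R : realType) (G : groupType)
    (hyp_G : hyperbolic_group R G) (nonelem_G : ~ virtually_cyclic G)
    (psi psi_s : G -> G -> R)
    (psi_dl : hyperbolic_distance_like psi)
    (psi_s_dl : hyperbolic_distance_like psi_s)
    (Dil_fin : (Dil psi_s psi < +oo)%E) :
  exists2 C : R, 0 <= C &
    forall x y : G,
      ((psi_s x y)%:E <= Dil psi_s psi * (psi x y)%:E + C%:E)%E.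
Proof.
have [S S_gen [delta delta_ge0 d_hyp]] := hyp_G.
have [C CP] := transverse_element S_gen delta_ge0 d_hyp
  nonelem_G psi_dl psi_s_dl.
have [lam [lam0 -> lamP]] := Dil_finite psi_dl Dil_fin.
exists ((lam + 1) * `|C|) => [|x y]; first by rewrite mulr_ge0// addr_ge0.
rewrite -EFinM -EFinD lee_fin (distance_like_translate psi_dl x).
rewrite (distance_like_translate psi_s_dl x).
have [z [z1 z2]] := CP (x^-1 * y)%g.
rewrite (le_trans z2)// (le_trans (lerD (lamP z) (ler_norm C)))//.
rewrite mulrDl mul1r addrA lerD2r -mulrDr ler_wpM2l//.
rewrite (le_trans (stable_length_le psi_dl z))// (le_trans z1)//.
by rewrite lerD2l ler_norm.
Qed.
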